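(* Let $1\le s\le k$ be integers, let $\tau_1,\dots,\tau_k\in[0,1]$ be distinct abscissae, and let $\ell_j$ be the $j$-th Lagrange polynomial of degree $k-1$ on $\{\tau_i\}$. Let $$\mathcal{A}=(\alpha_{ij})_{i,j=1}^k,\quad \alpha_{ij}=\int_0^{\tau_i}\ell_j(x)\,\mathrm{d}x,\qquad \omega_j=\int_0^1\ell_j(x)\,\mathrm{d}x,\quad j=1,\dots,k,$$ be the Butcher matrix and weights of the $k$-stage collocation Runge-Kutta method on these abscissae. Suppose that the quadrature formula $\int_0^1 g(t)\,\mathrm{d}t\approx\sum_{i=1}^k\omega_i g(\tau_i)$ is exact for all polynomials $g$ of degree at most $2s-1$. Then the Runge-Kutta method with abscissae $\tau_1,\dots,\tau_k$, weights $\omega_1,\dots,\omega_k$ and Butcher matrix $$A=\mathcal{A}\,(\mathcal{P}_s\mathcal{P}_s^T\Omega)$$ is the HBVM$(k,s)$ method based at the abscissae $\{\tau_i\}$.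
   Context: For $i\ge1$ let $P_i(t)=\sqrt{2i-1}\,\hat P_{i-1}(t)$, where $\hat P_{i-1}$ is the shifted Legendre polynomial of degree $i-1$ on $[0,1]$; thus $\int_0^1P_i(t)P_j(t)\,\mathrm{d}t=\delta_{ij}$ and $P_i$ has degree $i-1$. Given distinct abscissae $\tau_1,\dots,\tau_k$ and weights $\omega_1,\dots,\omega_k$, set $\Omega=\mathrm{diag}(\omega_1,\dots,\omega_k)$ and define $\mathcal{I}_s,\mathcal{P}_s\in\mathbb{R}^{k\times s}$ by $$(\mathcal{I}_s)_{ij}=\int_0^{\tau_i}P_j(x)\,\mathrm{d}x,\qquad(\mathcal{P}_s)_{ij}=P_j(\tau_i),\qquad i=1,\dots,k,\ j=1,\dots,s.$$ The method HBVM$(k,s)$ (Hamiltonian Boundary Value Method with $k$ steps and degree $s$) based at $\{\tau_i\}$, with quadrature weights $\{\omega_i\}$, applied with stepsize $h$ to $\dot y=f(y)$, $y(t_0)=y_0$, has stages $$y_i=y_0+h\sum_{j=1}^s\int_0^{\tau_i}P_j(x)\,\mathrm{d}x\ \sum_{\ell=1}^k\omega_\ell P_j(\tau_\ell)f(y_\ell),\qquad i=1,\dots,k,$$ i.e. it is the $k$-stage Runge-Kutta method with abscissae $\tau_i$, weights $\omega_i$ and Butcher matrix $\mathcal{I}_s\mathcal{P}_s^T\Omega$. Two Runge-Kutta methods are identified when their Butcher tableaux (abscissae, matrix, weights) are equal. *)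

(* Defs.v *)
From HB Require Import structures.
From mathcomp Require Import all_boot all_order all_algebra.
From mathcomp Require Import all_classical all_reals all_analysis.

Set Implicit Arguments.
Unset Strict Implicit.
Unset Printing Implicit Defensive.

Import Order.TTheory GRing.Theory Num.Theory.
Import numFieldNormedType.Exports.

Local Open Scope classical_set_scope.
Local Open Scope ring_scope.

Definition poly_integral (R : realType) (a b : R) (p : {poly R}) : R :=
  \int[lebesgue_measure]_(x in `[a, b]) p.[x].

(* Legendre polynomial on [-1, 1], by Rodrigues' formula. *)
Definition legendre (R : realType) (n : nat) : {poly R} :=
  ((2 ^+ n * n`!%:R)^-1) *: (('X ^+ 2 - 1) ^+ n)^`(n).

Definition shifted_legendre (R : realType) (n : nat) : {poly R} :=
  legendre R n \Po (2 *: 'X - 1).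

(* The orthonormal basis P_i on [0, 1], numbered from i = 1, so that P_i has
   degree i - 1; the value at i = 0 is never used. *)
Definition legendre_basis (R : realType) (i : nat) : {poly R} :=
  Num.sqrt (2 * i%:R - 1) *: shifted_legendre R i.-1.

(* The library's [x.-lagrange] needs nodes injective on the whole of [nat]. *)
Definition lagrange_poly (R : realType) (k : nat) (tau : 'rV[R]_k) (j : 'I_k) :
    {poly R} :=
  \prod_(m < k | m != j) ((tau 0 j - tau 0 m)^-1 *: ('X - (tau 0 m)%:P)).

Record butcher_tableau (R : realType) (k : nat) := ButcherTableau {
  rk_abscissae : 'rV[R]_k;
  rk_matrix : 'M[R]_k;
  rk_weights : 'rV[R]_k }.

Definition rk_stages (R : realType) (k : nat) (M : butcher_tableau R k)
    (V : lmodType R) (f : V -> V) (y0 : V) (h : R) (y : 'I_k -> V) : Prop :=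
  forall i, y i = y0 + h *: \sum_(j < k) rk_matrix M i j *: f (y j).

Definition collocation (R : realType) (k : nat) (tau : 'rV[R]_k) :
    butcher_tableau R k :=
  ButcherTableau tau
    (\matrix_(i, j) poly_integral 0 (tau 0 i) (lagrange_poly tau j))
    (\row_j poly_integral 0 1 (lagrange_poly tau j)).

(* In the next two matrices the column index j : 'I_s counts from 0, hence
   [j.+1]. *)
Definition Imx (R : realType) (k s : nat) (tau : 'rV[R]_k) : 'M[R]_(k, s) :=
  \matrix_(i, j) poly_integral 0 (tau 0 i) (legendre_basis R j.+1).

Definition Pmx (R : realType) (k s : nat) (tau : 'rV[R]_k) : 'M[R]_(k, s) :=
  \matrix_(i, j) (legendre_basis R j.+1).[tau 0 i].

Definition hbvm (R : realType) (k s : nat) (tau omega : 'rV[R]_k) :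
    butcher_tableau R k :=
  ButcherTableau tau (Imx s tau *m (Pmx s tau)^T *m diag_mx omega) omega.

(* The stage equations of [hbvm] are those by which the method is usually
   introduced. *)
Lemma hbvm_stagesE (R : realType) (k s : nat) (tau omega : 'rV[R]_k)
    (V : lmodType R) (f : V -> V) (y0 : V) (h : R) (y : 'I_k -> V) :
  rk_stages (hbvm s tau omega) f y0 h y <->
  forall i, y i = y0 + h *: \sum_(j < s)
    poly_integral 0 (tau 0 i) (legendre_basis R j.+1) *:
    \sum_(l < k) (omega 0 l * (legendre_basis R j.+1).[tau 0 l]) *: f (y l).
Proof.
suff E i : \sum_(l < k) rk_matrix (hbvm s tau omega) i l *: f (y l) =
    \sum_(j < s) poly_integral 0 (tau 0 i) (legendre_basis R j.+1) *:
    \sum_(l < k) (omega 0 l * (legendre_basis R j.+1).[tau 0 l]) *: f (y l).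
  by split=> H i; rewrite H E.
under [RHS]eq_bigr do rewrite scaler_sumr.
rewrite exchange_big /=; apply: eq_bigr => l _.
rewrite mul_mx_diag !mxE mulr_suml scaler_suml.
apply: eq_bigr => j _; rewrite !mxE scalerA; congr (_ *: _).
by rewrite -mulrA [_ * omega 0 l]mulrC.
Qed.

Definition quadrature_exact (R : realType) (k : nat) (tau omega : 'rV[R]_k)
    (d : nat) : Prop :=
  forall g : {poly R}, (size g <= d.+1)%N ->
    poly_integral 0 1 g = \sum_(i < k) omega 0 i * g.[tau 0 i].

(* Main.v *)
(* The stage matrix of the collocation method sends the vector (p (tau_j))_j to
   (\int_0^(tau_i) p)_i whenever p has degree less than k, because p is then its
   own Lagrange interpolant.  Applied to the columns of P_s this reads
   A_coll P_s = I_s, and it remains to multiply by P_s^T Omega. *)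
Require Import Defs.
From HB Require Import structures.
From mathcomp Require Import all_boot all_order all_algebra.
From mathcomp Require Import all_classical all_reals all_analysis.

Set Implicit Arguments.
Unset Strict Implicit.
Unset Printing Implicit Defensive.

Import Order.TTheory GRing.Theory Num.Theory.
Import numFieldNormedType.Exports.

Local Open Scope ring_scope.

(** Continuity on a compact segment; this supplies the side conditions for the linearity of the
    integral. *)
Lemma integrable_horner (R : realType) (a b : R) (p : {poly R}) :
  lebesgue_measure.-integrable `[a, b]%classic (EFin \o horner p).
Proof.
apply: continuous_compact_integrable; first exact: segment_compact.
exact/continuous_subspaceT/continuous_horner.
Qed.

Lemma poly_integralD (R : realType) (a b : R) :
  {morph @poly_integral R a b : p q / p + q}.
Proof.
move=> p q; rewrite /poly_integral.
rewrite -RintegralD //; try exact: integrable_horner.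
by apply: eq_Rintegral => x _; rewrite hornerD.
Qed.

Lemma poly_integralZ (R : realType) (a b c : R) (p : {poly R}) :
  poly_integral a b (c *: p) = c * poly_integral a b p.
Proof.
rewrite /poly_integral -RintegralZl //; last exact: integrable_horner.
by apply: eq_Rintegral => x _; rewrite hornerZ.
Qed.

Lemma poly_integral0 (R : realType) (a b : R) :
  poly_integral a b (0 : {poly R}) = 0.
Proof. by rewrite -(scale0r 0) poly_integralZ mul0r. Qed.

Lemma poly_integral_sum (R : realType) (a b : R) (I : Type) (r : seq I)
    (P : pred I) (F : I -> {poly R}) :
  poly_integral a b (\sum_(i <- r | P i) F i)
  = \sum_(i <- r | P i) poly_integral a b (F i).
Proof. exact: (big_morph _ (poly_integralD a b) (poly_integral0 a b)). Qed.

Lemma horner_lagrange_poly (R : realType) (k : nat) (tau : 'rV[R]_k)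
    (i j : 'I_k) :
  injective (tau 0) -> (lagrange_poly tau j).[tau 0 i] = (i == j)%:R.
Proof.
move=> tau_inj; rewrite /lagrange_poly horner_prod.
case: eqVneq => [->|neq_ij].
  (* At its own node every factor equals 1; the inverses are genuine because the nodes are
     distinct. *)
  apply: big1 => m neq_mj; rewrite hornerZ hornerXsubC mulVf // subr_eq0.
  by apply: contraNneq neq_mj => /tau_inj ->.
(* At another node [tau 0 i], the factor of index [i] vanishes. *)
by rewrite (bigD1 i) //= hornerZ hornerXsubC subrr mulr0 mul0r.
Qed.

Lemma size_lagrange_poly (R : realType) (k : nat) (tau : 'rV[R]_k) (j : 'I_k) :
  (size (lagrange_poly tau j) <= k)%N.
Proof.
rewrite /lagrange_poly scaler_prod (leq_trans (size_scale_leq _ _)) //.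
rewrite -big_filter size_prod_XsubC size_filter -sum1_count sum1_card cardC1.
by rewrite card_ord (ltn_predK (ltn_ord j)).
Qed.

(** The difference of the two sides has size at most [k] and vanishes at the [k] distinct nodes, so
    it is zero. *)
Lemma lagrange_interpolation (R : realType) (k : nat) (tau : 'rV[R]_k)
    (p : {poly R}) :
  injective (tau 0) -> (size p <= k)%N ->
  p = \sum_(j < k) p.[tau 0 j] *: lagrange_poly tau j.
Proof.
move=> tau_inj size_p; apply/eqP; rewrite -subr_eq0; apply/eqP.
apply: (@roots_geq_poly_eq0 _ _ [seq tau 0 i | i <- enum 'I_k]).
- apply/allP => _ /mapP[i _ ->]; rewrite rootE hornerD hornerN horner_sum.
  rewrite (bigD1 i) //= big1 => [|j neq_ji];
    rewrite hornerZ horner_lagrange_poly //.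
    by rewrite eqxx mulr1 addr0 subrr.
  by rewrite eq_sym (negPf neq_ji) mulr0.
- by rewrite (map_inj_uniq tau_inj) enum_uniq.
- rewrite size_map size_enum_ord (leq_trans (size_polyD _ _)) // geq_max size_p.
  rewrite size_polyN (leq_trans (size_sum _ _ _)) //; apply/bigmax_leqP => j _.
  exact: leq_trans (size_scale_leq _ _) (size_lagrange_poly _ _).
Qed.

Lemma size_legendre (R : realType) (n : nat) : (size (legendre R n) <= n.+1)%N.
Proof.
apply: leq_trans (size_scale_leq _ _) _.
have size_base : (size (('X ^+ 2 - 1 : {poly R}) ^+ n) <= (2 * n).+1)%N.
  by rewrite (leq_trans (size_poly_exp_leq _ _)) // -polyC1 size_XnsubC.
(* Coefficient [i] of the [n]-th derivative is a multiple of coefficient [n + i] of the base, which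
   is zero since [n + i > 2 * n]. *)
apply/leq_sizeP => i lt_ni; rewrite coef_derivn nth_default ?mul0rn //.
by rewrite (leq_trans size_base) // mul2n -addnn -addnS leq_add2l.
Qed.

Lemma size_legendre_basis (R : realType) (n : nat) :
  (size (legendre_basis R n.+1) <= n.+1)%N.
Proof.
apply: leq_trans (size_scale_leq _ _) _.
rewrite (leq_trans (size_comp_poly_leq _ _)) // ltnS.
have size_lin : (size ((2 *: 'X - 1)%R : {poly R}) <= 2)%N.
  rewrite (leq_trans (size_polyD _ _)) // geq_max size_polyN size_poly1 andbT.
  by rewrite (leq_trans (size_scale_leq _ _)) // size_polyX.
(* Degrees multiply under composition: at most [n] for the Legendre polynomial, at most 1 for the
   affine change of variable. *)
rewrite -[leqRHS]muln1 leq_mul //.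
- by case: size (size_legendre R n).
- by case: size size_lin.
Qed.

(** Column [j], counted from 0, comes from a polynomial of degree at most [j < s <= k], so
    interpolation reproduces it and can be integrated term by term. *)
Lemma collocation_mul_Pmx (R : realType) (k s : nat) (tau : 'rV[R]_k) :
  injective (tau 0) -> (s <= k)%N ->
  rk_matrix (collocation tau) *m Pmx s tau = Imx s tau.
Proof.
move=> tau_inj le_sk; apply/matrixP => i j; rewrite !mxE.
have size_j : (size (legendre_basis R j.+1) <= k)%N.
  exact: leq_trans (size_legendre_basis R j) (leq_trans (ltn_ord j) le_sk).
rewrite [in RHS](lagrange_interpolation tau_inj size_j) poly_integral_sum.
by apply: eq_bigr => l _; rewrite !mxE poly_integralZ mulrC.
Qed.

Theorem theorem2 (R : realType) (k s : nat) (hs : (1 <= s)%N) (hsk : (s <= k)%N)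
    (tau : 'rV[R]_k) (htau01 : forall i : 'I_k, 0 <= tau 0 i <= 1)
    (htau : injective (tau 0))
    (hquad : quadrature_exact tau (rk_weights (collocation tau)) (2 * s - 1)) :
  ButcherTableau tau
    (rk_matrix (collocation tau) *m
       (Pmx s tau *m (Pmx s tau)^T *m diag_mx (rk_weights (collocation tau))))
    (rk_weights (collocation tau))
  = hbvm s tau (rk_weights (collocation tau)).
(* Reassociating to the left exposes the product of the collocation matrix with [Pmx s tau]. *)
Proof. by rewrite /hbvm !mulmxA collocation_mul_Pmx. Qed.
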